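(* Suppose $\beta>0$. Then $$D_{\beta,0}=\inf_{\theta\in(0,\psi^{-1}(\beta)]}\Lambda(\beta,\theta).$$
   Context: Let $\mathcal{H}=\{(x,v)\in\mathbb{R}^2:v\ge0\}$ and let $d_H$ be the Riemannian distance on $\mathcal{H}$ induced by the metric $ds^2=v^{-1}(dx^2+dv^2)$ on the open upper half-plane (extended to the boundary). For $\beta,\gamma\in\mathbb{R}$, $D_{\beta,\gamma}=\inf_{v\ge0}\frac12 d_H((0,1),(\beta+\gamma v,v))^2$. The function $\psi(\theta)=\frac{\theta-\sin\theta}{1-\cos\theta}$ is a strictly increasing bijection of $(0,2\pi)$ onto $(0,\infty)$, and $\psi^{-1}$ denotes its inverse. For $\theta\ne0$ and admissible $x$, $$\Lambda(x,\theta)=\frac{\theta^2}{(\theta-\sin\theta)^2}\Big[(\theta-\sin\theta)x+2(1-\cos\theta)-\theta\sin\theta-(1-\cos\theta)\sqrt{2(\theta-\sin\theta)x+2(1-\cos\theta)-\theta^2}\Big],$$ with the nonnegative square root. *)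

(* Defs.v *)
From HB Require Import structures.
From mathcomp Require Import all_boot all_order all_algebra.
From mathcomp Require Import all_classical all_reals all_analysis.
Set Implicit Arguments. Unset Strict Implicit. Unset Printing Implicit Defensive.
Import Order.TTheory GRing.Theory Num.Theory.
Import numFieldNormedType.Exports.
Local Open Scope classical_set_scope.
Local Open Scope ring_scope.

Section Defs.
Variable R : realType.

Definition admissible_curve (x v : R -> R) : Prop :=
  (forall t : R, derivable x t 1) /\ (forall t : R, derivable v t 1) /\
  continuous (derive1 x) /\ continuous (derive1 v) /\
  (forall t : R, 0 <= t <= 1 -> 0 <= v t).

(* Riemannian speed for ds^2 = v^{-1}(dx^2 + dv^2); on the boundary v = 0 the
   speed is +oo unless the velocity vanishes. *)
Definition speedH (x v : R -> R) (t : R) : \bar R :=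
  if 0 < v t then (Num.sqrt (((derive1 x t) ^+ 2 + (derive1 v t) ^+ 2) / v t))%:E
  else if (derive1 x t == 0) && (derive1 v t == 0) then 0%E else +oo%E.

Definition lengthH (x v : R -> R) : \bar R :=
  (\int[@lebesgue_measure R]_(t in `[0%R, 1%R]) speedH x v t)%E.

Definition dH (p q : R * R) : \bar R :=
  ereal_inf [set l | exists x v : R -> R, admissible_curve x v /\
     x 0 = p.1 /\ v 0 = p.2 /\ x 1 = q.1 /\ v 1 = q.2 /\ l = lengthH x v].

Definition Dbg (beta gamma : R) : \bar R :=
  ereal_inf [set ((2^-1)%:E * (dH (0%R, 1%R) (beta + gamma * w, w)%R) ^+ 2)%E
             | w in [set w : R | 0 <= w]].

Definition psi (th : R) : R := (th - sin th) / (1 - cos th).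

Definition psi_inv (b : R) : R :=
  xget 0 [set th : R | 0 < th < 2 * pi /\ psi th = b].

Definition Lambda (x th : R) : R :=
  th ^+ 2 / (th - sin th) ^+ 2 *
  ((th - sin th) * x + 2 * (1 - cos th) - th * sin th
   - (1 - cos th) * Num.sqrt (2 * (th - sin th) * x + 2 * (1 - cos th) - th ^+ 2)).

End Defs.

(* Main.v *)
Require Import Defs.
From HB Require Import structures.
From mathcomp Require Import all_boot all_order all_algebra.
From mathcomp Require Import all_classical all_reals all_analysis.
From mathcomp Require Import measurable_realfun.
From mathcomp Require Import ring lra.
Set Implicit Arguments.
Unset Strict Implicit.
Unset Printing Implicit Defensive.
Import Order.TTheory GRing.Theory Num.Theory.
Import numFieldNormedType.Exports.
Local Open Scope classical_set_scope.
Local Open Scope ring_scope.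

(**
Geodesics of [ds^2 = (dx^2 + dv^2) / v] are cycloids. The distance from [(u, v)]
to a vertical line at signed horizontal distance [u] should be
[f (u, v) = 2 sqrt v h / cos h], where [h] solves [h / cos^2 h + tan h = u / v];
with [p = tan h] this is a smooth function on [v > 0] whose gradient has norm
exactly [1 / sqrt v]. Hence [f] is a calibration and bounds the length of every
curve reaching the line from below; curves touching the boundary [v = 0] are
handled by using [f (u, v + e)] and letting [e] tend to 0.

Conversely [Lambda beta th] is half of the squared length of a cycloid arc of
phase increment [th] from [(0, 1)] to the line [x = beta]; for [psi th <= beta]
the radicand in [Lambda] is nonnegative, so that this arc exists. The arc with
[th = 2 h] meets the line orthogonally and attains the calibration bound, and
[psi (2 h) <= beta], so it is one of the competitors.
*)

(** * Inversion of the foot-point equation *)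

Section SlopeRatio.
Variable R : realType.
Implicit Types (f df u w : R -> R) (p q y t a b : R).

Lemma continuous_within_itv f a b :
  (forall t, a <= t <= b -> {for t, continuous f}) ->
  {within `[a, b], continuous f}.
Proof.
move=> cf; apply/continuous_in_subspaceT => t /[!inE]/=.
by rewrite in_itv/=; exact: cf.
Qed.

Lemma is_derive_continuous f t (d : R) : is_derive t 1 f d -> {for t, continuous f}.
Proof. by move=> [fd _]; exact/differentiable_continuous/derivable1_diffP. Qed.

Lemma is_derive_gt0_lt f df a b : a < b ->
  (forall t, a <= t <= b -> is_derive t 1 f (df t)) ->
  (forall t, a < t < b -> 0 < df t) -> f a < f b.
Proof.
move=> ab fd df0.
have cf : {within `[a, b], continuous f}.
  by apply: continuous_within_itv => t /fd; exact: is_derive_continuous.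
have fd' t : t \in `]a, b[ -> is_derive t 1 f (df t).
  by rewrite in_itv/= => /andP[/ltW at_ /ltW tb]; apply: fd; rewrite at_ tb.
have [c] := MVT ab fd' cf; rewrite in_itv/= => /df0 dc fE.
by rewrite -subr_gt0 fE mulr_gt0// subr_gt0.
Qed.

(* With [p = tan h], this is [h / cos^2 h + tan h]. *)
Definition slope_ratio p : R := atan p * (1 + p ^+ 2) + p.

Lemma oneDsqr_gt0 p : 0 < 1 + p ^+ 2.
Proof. by rewrite ltr_pwDl// sqr_ge0. Qed.

Lemma mul_atan_ge0 p : 0 <= p * atan p.
Proof.
have [p0|/ltW p0] := leP 0 p.
  by rewrite mulr_ge0// -atan0 le_atan.
by rewrite mulr_le0// -atan0 le_atan.
Qed.

Lemma is_derive_slope_ratio p :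
  is_derive p 1 slope_ratio (2 * (1 + p * atan p)).
Proof.
apply: is_derive_eq.
rewrite /GRing.scale/=.
have /lt0r_neq0 := oneDsqr_gt0 p.
by move=> ?; field.
Qed.

Lemma slope_ratio_lt : {homo slope_ratio : p q / p < q}.
Proof.
move=> p q pq; apply: (is_derive_gt0_lt (df := fun t => 2 * (1 + t * atan t)) pq).
  by move=> t _; exact: is_derive_slope_ratio.
by move=> t _; rewrite mulr_gt0// ltr_pwDl// mul_atan_ge0.
Qed.

Lemma slope_ratio0 : slope_ratio 0 = 0.
Proof. by rewrite /slope_ratio atan0 mul0r addr0. Qed.

Lemma slope_ratio_inj : injective slope_ratio.
Proof.
move=> p q pq; case: (ltgtP p q) => // /slope_ratio_lt; by rewrite pq ltxx.
Qed.

(** Intermediate value theorem on the interval from [- |y|] to [|y|]: oddness together with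
    [q <= slope_ratio q] for [q >= 0] brackets [y]. *)
Lemma slope_ratio_surj y : exists p, slope_ratio p = y.
Proof.
have big q : 0 <= q -> q <= slope_ratio q.
  move=> q0; rewrite lerDr mulr_ge0 ?(ltW (oneDsqr_gt0 _))//.
  by rewrite -[0](@atan0 R) le_atan.
have oddK q : slope_ratio (- q) = - slope_ratio q.
  by rewrite /slope_ratio atanN sqrrN mulNr opprD.
have /andP[yl yu] : - slope_ratio `|y| <= y <= slope_ratio `|y|.
  by rewrite -ler_norml big.
have [|||p _ <-] := @IVT _ slope_ratio (- `|y|) `|y| y; last by exists p.
- by rewrite lerNl (le_trans _ (normr_ge0 y))// oppr_le0.
- apply: continuous_within_itv => t _.
  exact: is_derive_continuous (is_derive_slope_ratio t).
- by rewrite oddK ge_min le_max yl yu orbT.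
Qed.

Definition slope y : R := xget 0 [set p | slope_ratio p = y].

Lemma slopeK : cancel slope slope_ratio.
Proof.
move=> y; rewrite /slope; case: xgetP => [p _ //|/= no].
by have [p py] := slope_ratio_surj y; case: (no p).
Qed.

Lemma slope_ratioK : cancel slope_ratio slope.
Proof. by move=> p; apply: slope_ratio_inj; rewrite slopeK. Qed.

(** Since [p * atan p >= 0], the derivative of [slope_ratio] is at least 2, so its inverse is
    differentiable on the whole line. *)
Lemma is_derive_slope y :
  is_derive y 1 slope (2 * (1 + slope y * atan (slope y)))^-1.
Proof.
rewrite -{1}[y]slopeK; apply: is_derive_inverse.
- by near=> z; exact: slope_ratioK.
- by near=> z; exact: is_derive_continuous (is_derive_slope_ratio z).
- exact: is_derive_slope_ratio.
- by rewrite gt_eqF// mulr_gt0// ltr_pwDl// mul_atan_ge0.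
Unshelve. all: by end_near. Qed.

End SlopeRatio.

(** * The calibration and its gradient *)

Section Calibration.
Variable R : realType.
Implicit Types (u v w x : R -> R) (p t : R).

(** The function [f] of the overview at height [b] and signed distance [a], with [1 / cos h] written
    as [sqrt (1 + p^2)]. *)
Definition line_dist (a b : R) : R :=
  Num.sqrt b * (2 * atan (slope (a / b)) * Num.sqrt (1 + slope (a / b) ^+ 2)).

(** The gradient is the vector [(1, - p)] divided by [sqrt w * sqrt (1 + p^2)], of norm
    [1 / sqrt w]. *)
Lemma is_derive_line_dist u w t (du dw : R) : 0 < w t ->
  is_derive t 1 u du -> is_derive t 1 w dw ->
  is_derive t 1 (fun s => line_dist (u s) (w s))
    ((du - slope (u t / w t) * dw) /
     (Num.sqrt (w t) * Num.sqrt (1 + slope (u t / w t) ^+ 2))).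
Proof.
move=> w0 hu hw.
have hs : is_derive t 1 (fun s => Num.sqrt (w s)) ((2 * Num.sqrt (w t))^-1 * dw).
  exact: is_derive1_comp (is_derive1_sqrt w0) hw.
have hq : is_derive t 1 (fun s => u s / w s) ((du * w t - u t * dw) / w t ^+ 2).
  apply: is_derive_eq.
    apply: is_deriveM; apply: is_deriveV; exact: lt0r_neq0.
  rewrite /GRing.scale/=; have /lt0r_neq0 := w0.
  by move=> ?; field.
have hP := @is_derive1_comp R (@slope R) (fun s => u s / w s) _ _ _
  (is_derive_slope (u t / w t)) hq.
have ha := @is_derive1_comp R (@atan R) (fun s => slope (u s / w s)) _ _ _
  (is_derive1_atan _) hP.
set p := slope _ in ha hP *.
have hg : is_derive t 1 (fun s => Num.sqrt (1 + slope (u s / w s) ^+ 2))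
   ((2 * Num.sqrt (1 + p ^+ 2))^-1 * (2 * p * ((2 * (1 + p * atan p))^-1 *
       ((du * w t - u t * dw) / w t ^+ 2)))).
  apply: (@is_derive1_comp R Num.sqrt); first exact/is_derive1_sqrt/oneDsqr_gt0.
  apply: is_derive_eq; rewrite /GRing.scale/= -/p.
  by move: (_^-1 * _) => d; ring.
apply: is_derive_eq; rewrite /GRing.scale/=.
rewrite -/p.
have r0 : Num.sqrt (w t) != 0 by rewrite gt_eqF// sqrtr_gt0.
have wE : w t = Num.sqrt (w t) ^+ 2 by rewrite sqr_sqrtr// ltW.
have q0 : Num.sqrt (1 + p ^+ 2) != 0 by rewrite gt_eqF// sqrtr_gt0 oneDsqr_gt0.
have qE : 1 + p ^+ 2 = Num.sqrt (1 + p ^+ 2) ^+ 2.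
  by rewrite sqr_sqrtr// ltW// oneDsqr_gt0.
(* The defining equation of [p] eliminates [u t]; with both square roots taken as variables, the
   claim becomes a rational identity. *)
have uE : u t = (atan p * (1 + p ^+ 2) + p) * w t.
  by rewrite -[X in X * _]/(slope_ratio p) slopeK divfK// lt0r_neq0.
have k0 : 1 + p * atan p != 0 by rewrite gt_eqF// ltr_pwDl// mul_atan_ge0.
clear hs hq ha hP hg; rewrite {}uE.
move: qE q0 k0; clearbody p; move: (Num.sqrt (1 + p ^+ 2)) => q ->.
move: wE r0; move: (Num.sqrt (w t)) => r ->.
move: (atan p) => h r0 q0 k0; field.
by rewrite k0 q0 r0.
Qed.

(** Cauchy-Schwarz for [(du, dw)] and [(1, - p)]; the defect is the square of [p * du + dw]. *)
Lemma line_dist_grad_le (du dw b p : R) : 0 < b ->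
  `|(du - p * dw) / (Num.sqrt b * Num.sqrt (1 + p ^+ 2))| <=
  Num.sqrt ((du ^+ 2 + dw ^+ 2) / b).
Proof.
move=> b0; have p0 := oneDsqr_gt0 p.
rewrite -sqrtrM ?(ltW b0)// -sqrtr_sqr ler_wsqrtr// expr_div_n sqr_sqrtr; last first.
  by rewrite mulr_ge0// ltW.
rewrite ler_pdivrMr ?mulr_gt0// mulrA divfK ?gt_eqF//.
have := sqr_ge0 (p * du + dw); nra.
Qed.

Lemma line_dist_continuous (a b t : R) : 0 < b + t -> 
  {for t, continuous (fun s => line_dist a (b + s))}.
Proof.
move=> bt.
have db : is_derive t 1 (fun s => b + s) 1.
  by apply: is_derive_eq; rewrite add0r mulr1.
have da : is_derive t 1 (cst a : R -> R) 0 by exact: is_derive_cst.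
exact: is_derive_continuous (is_derive_line_dist (u := cst a) bt da db).
Qed.

End Calibration.

(** * Lower bound for the length of curves reaching a vertical line *)

Section Length.
Variable R : realType.
Implicit Types (x v : R -> R) (t b e : R).
Local Notation mu := (@lebesgue_measure R).

Lemma speedH_ge0 x v t : (0 <= speedH x v t)%E.
Proof.
by rewrite /speedH; case: ifP => // _; case: ifP.
Qed.

Lemma lengthH_ge0 x v : (0 <= lengthH x v)%E.
Proof. by apply: integral_ge0 => t _; exact: speedH_ge0. Qed.

Lemma measurable_speedH x v (D : set R) : measurable D -> admissible_curve x v ->
  measurable_fun D (speedH x v).
Proof.
move=> mD [_ [dv [cx [cv _]]]].
have cv0 : continuous v.
  by move=> t; exact/differentiable_continuous/derivable1_diffP.
have mv : measurable_fun setT v by exact: continuous_measurable_fun.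
apply: measurable_funTS; rewrite /speedH; apply: measurable_fun_if => //.
- exact: measurable_fun_ltr.
- rewrite setTI; apply/measurable_EFinP; apply: open_continuous_measurable_fun.
    rewrite preimage_true; apply: (@open_comp _ _ v [set y | 0 < y]).
      by move=> t _; exact: cv0.
    exact: open_gt.
  move=> t; rewrite inE/= => v0.
  have cq : {for t, continuous (fun s => (derive1 x s ^+ 2 + derive1 v s ^+ 2) / v s)}.
    apply: (@continuousM _ _ (fun s => derive1 x s ^+ 2 + derive1 v s ^+ 2)
      (fun s => (v s)^-1)).
      by apply: (@continuousD _ _ _ (fun s => derive1 x s ^+ 2)
        (fun s => derive1 v s ^+ 2)); apply: continuousM; [exact: cx..|exact: cv|exact: cv].
    by apply: continuousV; [rewrite gt_eqF|exact: cv0].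
  exact: continuous_comp cq (@sqrt_continuous _ _).
- apply: measurable_funTS; apply: measurable_fun_ifT => //.
  by apply: measurable_and; apply: measurable_fun_eqr => //;
    exact: continuous_measurable_fun.
Qed.

(** Inside the half-plane, replacing [v] by [v + e] shrinks the speed. On the boundary either the
    velocity vanishes, and so does the left side, or the speed is infinite. *)
Lemma speedH_ge x v t (p e : R) : 0 <= v t -> 0 < e ->
  ((`|(- derive1 x t - p * derive1 v t) /
      (Num.sqrt (v t + e) * Num.sqrt (1 + p ^+ 2))|)%:E <= speedH x v t)%E.
Proof.
move=> v0 e0; rewrite /speedH; case: ltP => [vt|_].
  rewrite lee_fin (le_trans (line_dist_grad_le _ _ _ _)) ?addr_gt0//.
  rewrite sqrrN ler_wsqrtr// ler_wpM2l ?addr_ge0 ?sqr_ge0//.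
  by rewrite lef_pV2 ?posrE ?addr_gt0// lerDl ltW.
case: ifP => [/andP[/eqP-> /eqP->]|_]; last by rewrite leey.
by rewrite oppr0 mulr0 subr0 mul0r normr0.
Qed.

(* Shifting [v] by [e] keeps the calibration smooth up to the boundary and only
   decreases its gradient. *)
Lemma lengthH_ge x v b e : admissible_curve x v -> 0 < e ->
  ((line_dist (b - x 0) (v 0 + e) - line_dist (b - x 1) (v 1 + e))%:E
    <= lengthH x v)%E.
Proof.
move=> xv e0; have [dx [dv [cx [cv v0]]]] := xv.
pose F t := line_dist (b - x t) (v t + e).
pose p t := slope ((b - x t) / (v t + e)).
pose dF t := (- derive1 x t - p t * derive1 v t) /
  (Num.sqrt (v t + e) * Num.sqrt (1 + p t ^+ 2)).
have w0 t : 0 <= t <= 1 -> 0 < v t + e by move=> /v0 vt; rewrite ltr_wpDl.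
have du t : is_derive t 1 (fun s => b - x s) (- derive1 x t).
  have := derivableP (dx t); rewrite -derive1E => h.
  by apply: is_derive_eq; rewrite add0r mul1r.
have dw t : is_derive t 1 (fun s => v s + e) (derive1 v t).
  have := derivableP (dv t); rewrite -derive1E => h.
  by apply: is_derive_eq; rewrite addr0.
have FdF t : 0 <= t <= 1 -> is_derive t 1 F (dF t).
  by move=> t01; apply: is_derive_line_dist => //; exact: w0.
have cu t : {for t, continuous (fun s => b - x s)}.
  exact: is_derive_continuous (du t).
have cw t : {for t, continuous (fun s => v s + e)}.
  exact: is_derive_continuous (dw t).
have cp t : 0 <= t <= 1 -> {for t, continuous p}.
  move=> /w0 wt; pose q s := (b - x s) / (v s + e).
  have cq : {for t, continuous q}.
    apply: (@continuousM _ _ (fun s => b - x s) (fun s => (v s + e)^-1)) => //.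
    by apply: (@continuousV _ _ (fun s => v s + e)); [rewrite gt_eqF|exact: cw].
  exact: (continuous_comp cq (is_derive_continuous (is_derive_slope _))).
have cdF : {within `[0, 1], continuous dF}.
  apply: continuous_within_itv => t t01.
  apply: (@continuousM _ _ (fun s => - derive1 x s - p s * derive1 v s)
    (fun s => (Num.sqrt (v s + e) * Num.sqrt (1 + p s ^+ 2))^-1)).
    apply: (@continuousB _ _ _ (fun s => - derive1 x s)).
      by apply: (@continuousN _ _ _ (derive1 x)); exact: cx.
    by apply: continuousM; [exact: cp|exact: cv].
  apply: (@continuousV _ _
    (fun s => Num.sqrt (v s + e) * Num.sqrt (1 + p s ^+ 2))).
    by rewrite mulf_neq0// gt_eqF// sqrtr_gt0 ?oneDsqr_gt0// w0.
  apply: (@continuousM _ _ (fun s => Num.sqrt (v s + e))).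
    exact: (continuous_comp (cw t) (@sqrt_continuous _ _)).
  have cq : {for t, continuous (fun s => 1 + p s ^+ 2)}.
    apply: (@continuousD _ _ _ (fun=> 1 : R) (fun s => p s ^+ 2)).
      exact: cst_continuous.
    by apply: continuousM; exact: cp.
  exact: (continuous_comp cq (@sqrt_continuous _ _)).
have ftc : (\int[mu]_(t in `[0%R, 1%R]) (dF t)%:E = (F 1)%:E - (F 0)%:E)%E.
  apply: continuous_FTC2 => //.
  - split.
    + move=> t; rewrite in_itv/= => /andP[/ltW t0 /ltW t1].
      by have [] := FdF t _; rewrite ?t0.
    + apply: cvg_at_right_filter.
      by apply: (is_derive_continuous (FdF 0 _)); rewrite lexx ler01.
    + apply: cvg_at_left_filter.
      by apply: (is_derive_continuous (FdF 1 _)); rewrite lexx ler01.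
  - move=> t; rewrite in_itv/= => /andP[/ltW t0 /ltW t1].
    by rewrite derive1E; have [|_ ->//] := FdF t _; rewrite t0.
have mdF : measurable_fun (`[0%R, 1%R] : set R) (EFin \o dF).
  apply/measurable_EFinP; apply: subspace_continuous_measurable_fun => //.
have : (\int[mu]_(t in `[0%R, 1%R]) `|(dF t)%:E| <= lengthH x v)%E.
  apply: ge0_le_integral => //.
  - exact: measurableT_comp mdF.
  - exact: measurable_speedH.
  - move=> t/=; rewrite in_itv/= => t01.
    by rewrite speedH_ge// v0.
(* The drop [F 0 - F 1] is at most the absolute value of the integral of [dF]. *)
apply: le_trans; apply: le_trans (le_abse_integral _ _ _) => //.
by rewrite ftc -EFinB/= lee_fin distrC ler_norm.
Qed.

(** On the line the calibration vanishes at every height, so only the term at time 0 survives; then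
    [e] tends to 0 by continuity at [v 0 > 0]. *)
Lemma lengthH_ge_line_dist x v b : admissible_curve x v -> 0 < v 0 -> x 1 = b ->
  ((line_dist (b - x 0) (v 0))%:E <= lengthH x v)%E.
Proof.
move=> xv v0 x1.
have le_len e : 0 < e -> ((line_dist (b - x 0) (v 0 + e))%:E <= lengthH x v)%E.
  move=> e0; apply: le_trans (lengthH_ge b xv e0).
  rewrite x1 subrr /line_dist mul0r.
  have -> : slope 0 = 0 :> R by rewrite -[X in slope X]slope_ratio0 slope_ratioK.
  by rewrite atan0 !(mulr0, mul0r) subr0.
case: (lengthH x v) (lengthH_ge0 x v) le_len => [l _ le_len|_ _|]; last by rewrite leeNy_eq.
  2: by rewrite leey.
rewrite lee_fin; set f := fun e => line_dist (b - x 0) (v 0 + e).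
have cf : f e @[e --> 0^'+] --> f 0.
  by apply: cvg_at_right_filter; apply: line_dist_continuous; rewrite addr0.
have -> : line_dist (b - x 0) (v 0) = f 0 by rewrite /f addr0.
rewrite leNgt; apply/negP => lf; near (0 : R)^'+ => e.
have : l < f e by near: e; exact: (cvgr_gt _ cf).
apply/negP; rewrite -leNgt; have := le_len e; rewrite lee_fin; apply.
by near: e; exact: nbhs_right_gt.
Unshelve. all: by end_near. Qed.

End Length.

(** * Half-angle estimates and monotonicity of [psi] *)

Section Trigonometry.
Variable R : realType.
Implicit Types (th t : R).

Lemma oneBcos_half th : 1 - cos th = 2 * sin (th / 2) ^+ 2.
Proof.
have {1}-> : th = (th / 2) *+ 2 by rewrite -mulr_natr divfK.
by rewrite sin2cos2 cos_mulr2n -mulr_natr; ring.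
Qed.

Lemma oneBcos_gt0 th : 0 < th < 2 * pi -> 0 < 1 - cos th.
Proof.
move=> /andP[th0 th2]; rewrite oneBcos_half mulr_gt0// exprn_gt0//.
by apply: sin_gt0_pi; rewrite divr_gt0//= ltr_pdivrMr// mulrC.
Qed.

Lemma sin_lt_id th : 0 < th < 2 * pi -> sin th < th.
Proof.
move=> /andP[th0 th2]; rewrite -subr_gt0.
rewrite -[X in X < _](_ : 0 - sin 0 = 0); last by rewrite sin0 subr0.
apply: (is_derive_gt0_lt (f := fun t => t - sin t) (df := fun t => 1 - cos t)) => //.
by move=> t /andP[t0 tth]; apply: oneBcos_gt0; rewrite t0 (lt_trans tth).
Qed.

Lemma mulr_cos_lt_sin t : 0 < t < pi -> t * cos t < sin t.
Proof.
move=> /andP[t0 tpi]; rewrite -subr_gt0.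
rewrite -[X in X < _](_ : sin 0 - 0 * cos 0 = 0); last by rewrite sin0 mul0r subr0.
apply: (is_derive_gt0_lt (f := fun t => sin t - t * cos t)
  (df := fun t => t * sin t)) => //.
  by move=> u _; apply: is_derive_eq; rewrite /GRing.scale/=; ring.
by move=> u /andP[u0 ut]; rewrite mulr_gt0// sin_gt0_pi// u0 (lt_trans ut).
Qed.

Lemma is_derive_psi t : 0 < t < 2 * pi ->
  is_derive t 1 (@psi R) ((2 * (1 - cos t) - t * sin t) / (1 - cos t) ^+ 2).
Proof.
move=> /oneBcos_gt0 /lt0r_neq0 ct0.
have hc : is_derive t 1 (fun s => 1 - cos s) (sin t).
  by apply: is_derive_eq; rewrite add0r mul1r opprK.
have hV := @is_deriveV R (fun s => 1 - cos s) t (sin t) 1 ct0 hc.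
apply: is_derive_eq; rewrite /GRing.scale/=.
have -> : 2 * (1 - cos t) - t * sin t = (1 - cos t) ^+ 2 - (t - sin t) * sin t.
  have -> : (1 - cos t) ^+ 2 - (t - sin t) * sin t =
      (cos t ^+ 2 + sin t ^+ 2) + 1 - 2 * cos t - t * sin t by ring.
  by rewrite cos2Dsin2; ring.
by field.
Qed.

Lemma psi_lt (th1 th2 : R) : 0 < th1 -> th1 < th2 -> th2 < 2 * pi ->
  psi th1 < psi th2.
Proof.
move=> th10 th12 th2pi.
apply: (is_derive_gt0_lt (f := @psi R)
  (df := fun t => (2 * (1 - cos t) - t * sin t) / (1 - cos t) ^+ 2)) => //.
  move=> t /andP[t1 t2]; apply: is_derive_psi.
  by rewrite (lt_le_trans th10)// (le_lt_trans t2).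
move=> t /andP[t1 t2].
have ct : 0 < 1 - cos t by apply: oneBcos_gt0; rewrite (lt_trans th10)// (lt_trans t2).
rewrite divr_gt0 ?exprn_gt0//.
have tpi : 0 < t / 2 < pi.
  rewrite divr_gt0 ?ltr_pdivrMr// ?(lt_trans th10)//=.
  by rewrite mulrC (lt_trans t2).
(* In half angles the numerator of the derivative factors, and [mulr_cos_lt_sin] at [t / 2] gives
   its sign. *)
have -> : 2 * (1 - cos t) - t * sin t =
    4 * (sin (t / 2) * (sin (t / 2) - t / 2 * cos (t / 2))).
  have tE : t = (t / 2) *+ 2 by rewrite -mulr_natr divfK.
  rewrite oneBcos_half [in sin t]tE sin_mulr2n -mulr_natr.
  by move: (sin (t / 2)) (cos (t / 2)) => ? ?; field.
by rewrite !mulr_gt0 ?sin_gt0_pi// subr_gt0 mulr_cos_lt_sin.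
Qed.

End Trigonometry.

(** * Cycloid arcs and their lengths *)

Section Cycloid.
Variable R : realType.
Implicit Types (th s t beta : R).
Local Notation mu := (@lebesgue_measure R).

(* The cycloid of radius [a = (s^2 + 1) / 2] through [(0, 1)] at phase [phi0],
   where [a cos phi0 = a - 1] and [a sin phi0 = s]; [th] is the phase increment. *)
Definition cyc_v s th : R :=
  (s ^+ 2 + 1) / 2 - (s ^+ 2 - 1) / 2 * cos th + s * sin th.

Definition cyc_x s th : R :=
  (s ^+ 2 + 1) / 2 * (th - sin th) + s * (1 - cos th) + sin th.

Lemma is_derive_cyc_v s th :
  is_derive th 1 (cyc_v s) ((s ^+ 2 - 1) / 2 * sin th + s * cos th).
Proof. by apply: is_derive_eq; rewrite /GRing.scale/=; ring. Qed.

Lemma is_derive_cyc_x s th : is_derive th 1 (cyc_x s) (cyc_v s th).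
Proof. by apply: is_derive_eq; rewrite /GRing.scale/= /cyc_v; field. Qed.

(** Since the phase derivative of [cyc_x] is [cyc_v], this says that the Riemannian speed in the
    phase is the constant [sqrt (s^2 + 1)] wherever [cyc_v] is positive. It also forces [cyc_v] to
    be nonnegative. *)
Lemma cyc_arclength s th :
  cyc_v s th ^+ 2 + ((s ^+ 2 - 1) / 2 * sin th + s * cos th) ^+ 2 =
  (s ^+ 2 + 1) * cyc_v s th.
Proof.
apply/eqP; rewrite -subr_eq0 /cyc_v; apply/eqP.
transitivity (((s ^+ 2 + 1) / 2) ^+ 2 * (cos th ^+ 2 + sin th ^+ 2 - 1)).
  by move: (cos th) (sin th) => c d; field.
by rewrite cos2Dsin2 subrr mulr0.
Qed.

Lemma cyc_v_ge0 s th : 0 <= cyc_v s th.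
Proof.
have s0 : 0 < s ^+ 2 + 1 by rewrite ltr_wpDl// sqr_ge0.
by rewrite -(pmulr_rge0 _ s0) -cyc_arclength addr_ge0// sqr_ge0.
Qed.

Lemma dH_cycloid_le s th : 0 <= th ->
  (dH (0%R, 1%R) (cyc_x s th, cyc_v s th) <= (th * Num.sqrt (s ^+ 2 + 1))%:E)%E.
Proof.
move=> th0.
pose x t := cyc_x s (th * t); pose v t := cyc_v s (th * t).
have dm t : is_derive t 1 ( *%R th) th.
  by apply: is_derive_eq; rewrite /GRing.scale/= mulr1.
have hx t : is_derive t 1 x (v t * th).
  exact: is_derive1_comp (is_derive_cyc_x _ _) (dm t).
have hv t : is_derive t 1 v
    (((s ^+ 2 - 1) / 2 * sin (th * t) + s * cos (th * t)) * th).
  exact: is_derive1_comp (is_derive_cyc_v _ _) (dm t).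
have x'E : derive1 x = (fun t => v t * th).
  by apply/funext => t; rewrite derive1E; have [_ ->] := hx t.
have v'E : derive1 v =
    (fun t => ((s ^+ 2 - 1) / 2 * sin (th * t) + s * cos (th * t)) * th).
  by apply/funext => t; rewrite derive1E; have [_ ->] := hv t.
have xv : admissible_curve x v.
  split; [|split; [|split; [|split]]].
  - by move=> t; have [] := hx t.
  - by move=> t; have [] := hv t.
  - rewrite x'E => t; apply: (@continuousM _ _ v (fun=> th)).
      exact: is_derive_continuous (hv t).
    exact: cst_continuous.
  - rewrite v'E => t; apply: is_derive_continuous; apply: is_deriveM.
  - by move=> t _; exact: cyc_v_ge0.
apply: (@le_trans _ _ (lengthH x v)).
  apply: ereal_inf_lbound; exists x, v; split=> //=.
  rewrite /x /v /cyc_x /cyc_v !mulr1 !mulr0 sin0 cos0.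
  by do !split => //; field.
have -> : (th * Num.sqrt (s ^+ 2 + 1))%:E =
    (\int[mu]_(t in `[0%R, 1%R]) (cst (th * Num.sqrt (s ^+ 2 + 1))%:E) t)%E.
  rewrite integral_cst//= lebesgue_measure_itv/= lte_fin ltr01.
  by rewrite oppr0 adde0 mule1.
apply: ge0_le_integral => //.
- by move=> t _; exact: speedH_ge0.
- exact: measurable_speedH.
move=> t _; rewrite /speedH; case: ltP => [vt|vt].
  rewrite lee_fin x'E v'E !exprMn -mulrDl cyc_arclength mulrAC mulfK ?gt_eqF//.
  by rewrite mulrC sqrtrM ?sqr_ge0// sqrtr_sqr ger0_norm.
(* At a cusp the arclength identity makes the velocity vanish, so the speed there is 0 and not
   infinite. *)
have vt0 : v t = 0 by apply/eqP; rewrite eq_le vt cyc_v_ge0.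
have := cyc_arclength s (th * t); rewrite -/(v t) vt0 expr0n/= mulr0 add0r.
move/eqP; rewrite sqrf_eq0 => /eqP v't.
by rewrite x'E v'E vt0 v't !mul0r eqxx/= lee_fin mulr_ge0// sqrtr_ge0.
Qed.

(** At [x = cyc_x s th] the radicand is the perfect square of [(th - sin th) * s + (1 - cos th)],
    and the sign hypothesis selects its nonnegative root. The value is half the squared length of
    the arc. *)
Lemma Lambda_cyc_x s th : sin th < th ->
  0 <= (th - sin th) * s + (1 - cos th) ->
  Lambda (cyc_x s th) th = (s ^+ 2 + 1) / 2 * th ^+ 2.
Proof.
rewrite -subr_gt0 => d0 r0; have cd := cos2Dsin2 th; rewrite /Lambda /cyc_x.
set a := (s ^+ 2 + 1) / 2.
have -> : 2 * (th - sin th) * (a * (th - sin th) + s * (1 - cos th) + sin th) +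
    2 * (1 - cos th) - th ^+ 2 = ((th - sin th) * s + (1 - cos th)) ^+ 2.
  apply/eqP; rewrite -subr_eq0; apply/eqP.
  transitivity (1 - (cos th ^+ 2 + sin th ^+ 2)); last by rewrite cd subrr.
  by rewrite /a; move: (cos th) (sin th) => c d; field.
rewrite sqrtr_sqr ger0_norm//; set B := (X in _ * X = _).
have -> : B = a * (th - sin th) ^+ 2.
  apply/eqP; rewrite -subr_eq0; apply/eqP.
  transitivity (1 - (cos th ^+ 2 + sin th ^+ 2)); last by rewrite cd subrr.
  by rewrite /B; move: (cos th) (sin th) => c d; ring.
by rewrite mulrCA divfK// expf_neq0// lt0r_neq0.
Qed.

(** The equation is quadratic in [s], with the radicand of [Lambda] as reduced discriminant. The
    larger root satisfies the sign condition of [Lambda_cyc_x]. *)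
Lemma exists_cyc_x beta th : 0 < th < 2 * pi -> psi th <= beta ->
  exists2 s, 0 <= (th - sin th) * s + (1 - cos th) & cyc_x s th = beta.
Proof.
move=> thpi; have c0 := oneBcos_gt0 thpi.
have := sin_lt_id thpi; rewrite -subr_gt0 => d0.
rewrite /psi ler_pdivrMr// => psib.
pose disc := 2 * (th - sin th) * beta + 2 * (1 - cos th) - th ^+ 2.
have sin2E : sin th ^+ 2 = (1 - cos th) * (1 + cos th) by rewrite sin2cos2; ring.
have disc0 : 0 <= disc.
  (* This is [disc * (1 - cos th)] at the smallest allowed value [beta = psi th]; [disc] increases
     with [beta]. *)
  pose q := 2 * (th - sin th) ^+ 2 + (2 * (1 - cos th) - th ^+ 2) * (1 - cos th).
  have q0 : 0 <= q.
    rewrite -(pmulr_lge0 _ c0).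
    have -> : q * (1 - cos th) = (th * sin th - 2 * (1 - cos th)) ^+ 2.
      apply/eqP; rewrite -subr_eq0; apply/eqP.
      transitivity ((2 * (1 - cos th) - th ^+ 2) *
        (sin th ^+ 2 - (1 - cos th) * (1 + cos th))).
        by rewrite /q; move: (cos th) (sin th) => c d; ring.
      by rewrite sin2E subrr mulr0.
    exact: sqr_ge0.
  rewrite -(pmulr_lge0 _ c0); apply: (le_trans q0).
  have -> : disc * (1 - cos th) = 2 * (th - sin th) * (beta * (1 - cos th)) +
      (2 * (1 - cos th) - th ^+ 2) * (1 - cos th) by rewrite /disc; ring.
  by rewrite lerD2r expr2 mulrA ler_wpM2l// mulr_ge0// ltW.
exists ((Num.sqrt disc - (1 - cos th)) / (th - sin th)).
  by rewrite mulrC divfK ?gt_eqF// subrK sqrtr_ge0.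
transitivity ((Num.sqrt disc ^+ 2 - (1 - cos th) ^+ 2 + th ^+ 2 - sin th ^+ 2) /
    (2 * (th - sin th))).
  rewrite /cyc_x; move: (Num.sqrt disc) (cos th) (sin th) (lt0r_neq0 d0).
  by move=> r c d d0'; field.
rewrite sqr_sqrtr// sin2E /disc; move: (cos th) (sin th) (lt0r_neq0 d0).
by move=> c d d0'; field.
Qed.

End Cycloid.

(** * The arc orthogonal to the line, and the inverse of [psi] *)

Section FootPoint.
Variable R : realType.
Implicit Types (p th beta : R).

Lemma cos_2atan p : cos (2 * atan p) = (1 - p ^+ 2) / (1 + p ^+ 2).
Proof.
rewrite mulrC mulr_natr cos_mulr2n cos_atan exprVn sqr_sqrtr ?(ltW (oneDsqr_gt0 _))//.
by have /lt0r_neq0 := oneDsqr_gt0 p; rewrite -mulr_natr => ?; field.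
Qed.

Lemma sin_2atan p : sin (2 * atan p) = 2 * p / (1 + p ^+ 2).
Proof.
have c0 : cos (atan p) != 0.
  by rewrite gt_eqF// cos_gt0_pihalf// atan_gtNpi2 atan_ltpi2.
rewrite mulrC mulr_natr sin_mulr2n -(divfK c0 (sin (atan p))).
rewrite -/(tan (atan p)) atanK mulrCA -expr2 cos_atan exprVn sqr_sqrtr; last first.
  exact/ltW/oneDsqr_gt0.
by rewrite -mulr_natr mulrC mulrA.
Qed.

(** The arc with initial slope [p] is at its top at phase [2 * atan p], where its velocity is
    horizontal. Hence [slope beta] is the initial slope of the arc meeting [x = beta]
    orthogonally. *)
Lemma cyc_x_2atan p : cyc_x p (2 * atan p) = slope_ratio p.
Proof.
rewrite /cyc_x /slope_ratio cos_2atan sin_2atan.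
by have /lt0r_neq0 := oneDsqr_gt0 p; move: (atan p) => h ?; field.
Qed.

Lemma atan_gt0 p : 0 < p -> 0 < atan p.
Proof. by move=> p0; rewrite -[X in X < _](@atan0 R) lt_atan. Qed.

Lemma atan_2_itv p : 0 < p -> 0 < 2 * atan p < pi.
Proof.
by move=> p0; rewrite mulr_gt0 ?atan_gt0//= mulrC -ltr_pdivlMr// atan_ltpi2.
Qed.

Lemma atan_2_itv2 p : 0 < p -> 0 < 2 * atan p < 2 * pi.
Proof.
move=> /atan_2_itv/andP[-> h]/=; apply: (lt_trans h).
by rewrite ltr_pMl ?pi_gt0// ltr1n.
Qed.

Lemma atan_lt_id p : 0 < p -> atan p < p.
Proof.
move=> p0; have h0 := atan_gt0 p0.
have c0 : 0 < cos (atan p) by rewrite cos_gt0_pihalf// atan_gtNpi2 atan_ltpi2.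
rewrite -[ltRHS]atanK ltr_pdivlMr// mulr_cos_lt_sin// h0/=.
by rewrite (lt_trans (atan_ltpi2 _))// ltr_pdivrMr// ltr_pMr ?pi_gt0// ltr1n.
Qed.

Lemma slope_gt0 beta : 0 < beta -> 0 < slope beta.
Proof.
move=> b0; rewrite ltNge; apply/negP; rewrite le_eqVlt => /orP[/eqP s0|/slope_ratio_lt].
  by move: b0; rewrite -[beta]slopeK s0 slope_ratio0 ltxx.
by rewrite slopeK slope_ratio0 => /(lt_trans b0); rewrite ltxx.
Qed.

(** After multiplication by [1 - cos (2 * atan p)] the difference is [2 * (p - h + h * p^2)] with
    [h = atan p < p]. This makes the orthogonal arc a competitor. *)
Lemma psi_2atan_le p : 0 < p -> psi (2 * atan p) <= slope_ratio p.
Proof.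
move=> p0; have q0 := oneDsqr_gt0 p; have q1 := lt0r_neq0 q0.
have ap := atan_lt_id p0; have a0 := atan_gt0 p0.
rewrite ler_pdivrMr ?oneBcos_gt0 ?atan_2_itv2//.
rewrite sin_2atan cos_2atan /slope_ratio; move: (atan p) ap a0 => h hp h0.
rewrite -subr_ge0.
have -> : (h * (1 + p ^+ 2) + p) * (1 - (1 - p ^+ 2) / (1 + p ^+ 2)) -
    (2 * h - 2 * p / (1 + p ^+ 2)) = 2 * (p - h + h * p ^+ 2) by field.
by rewrite mulr_ge0// addr_ge0 ?subr_ge0 ?(ltW hp)// mulr_ge0 ?sqr_ge0// ltW.
Qed.

(** The intermediate value theorem yields a preimage, which excludes the default value of [xget]. *)
Lemma psi_invP beta : 0 < beta ->
  0 < psi_inv beta < 2 * pi /\ psi (psi_inv beta) = beta.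
Proof.
move=> b0; rewrite /psi_inv; case: xgetP => [th _ //|no]; exfalso.
have p0 := slope_gt0 b0; have /andP[a0 api] := atan_2_itv p0.
have /andP[g0 gpi] := atan_2_itv b0.
(* Chosen so that [- sin th1 = beta * (1 - cos th1)]; adding [th1 > 0] to the left side gives
   [beta <= psi th1]. *)
pose th1 := pi + 2 * atan beta.
have th12 : 2 * atan (slope beta) <= th1 by rewrite (le_trans (ltW api))// lerDl ltW.
have th1pi : th1 < 2 * pi by rewrite mulr_natl mulr2n ltrD2l.
have th1b : beta <= psi th1.
  rewrite ler_pdivlMr; last first.
    by rewrite oneBcos_gt0// th1pi (lt_le_trans a0).
  rewrite /th1 (addrC pi) cosDpi sinDpi !opprK cos_2atan sin_2atan.
  have /lt0r_neq0 q0 := oneDsqr_gt0 beta.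
  have -> : beta * (1 + (1 - beta ^+ 2) / (1 + beta ^+ 2)) =
    2 * beta / (1 + beta ^+ 2) by field.
  by rewrite lerDr addr_ge0 ?pi_ge0// ltW.
have [||th] := @IVT R (@psi R) (2 * atan (slope beta)) th1 beta th12.
- apply: continuous_within_itv => t /andP[t0 t1].
  apply: is_derive_continuous; apply: is_derive_psi.
  by rewrite (lt_le_trans a0)// (le_lt_trans t1).
- rewrite ge_min le_max th1b orbT andbT.
  by rewrite -[X in _ <= X]slopeK psi_2atan_le.
rewrite in_itv/= => /andP[t0 t1] thb; apply: (no th); split=> //.
by rewrite (lt_le_trans a0)// (le_lt_trans t1).
Qed.

Lemma atan_2_le_psi_inv beta : 0 < beta -> 2 * atan (slope beta) <= psi_inv beta.
Proof.
move=> b0; have [/andP[i0 ipi] iE] := psi_invP b0.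
have p0 := slope_gt0 b0; have /andP[_ a1] := atan_2_itv2 p0.
rewrite leNgt; apply/negP => /(psi_lt i0)/(_ a1); rewrite iE.
by apply/negP; rewrite -leNgt -[leRHS]slopeK psi_2atan_le.
Qed.

Lemma psi_le_of_le_psi_inv beta th : 0 < beta -> 0 < th <= psi_inv beta ->
  psi th <= beta.
Proof.
move=> b0 /andP[th0]; have [/andP[_ ipi] iE] := psi_invP b0.
rewrite le_eqVlt => /orP[/eqP->|thi]; first by rewrite iE.
by rewrite -[leRHS]iE ltW// psi_lt.
Qed.

(** The orthogonal arc attains the calibration bound: with [p = slope beta] and [h = atan p], both
    sides are [2 * h^2 * (1 + p^2)]. *)
Lemma Lambda_slope beta : 0 < beta ->
  Lambda beta (2 * atan (slope beta)) = 2^-1 * (line_dist beta 1 * line_dist beta 1).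
Proof.
move=> b0; have p0 := slope_gt0 b0; have ap := atan_2_itv2 p0.
rewrite -{1}[beta]slopeK -cyc_x_2atan Lambda_cyc_x ?sin_lt_id//; last first.
  rewrite addr_ge0 ?(ltW (oneBcos_gt0 _))// mulr_ge0 ?(ltW p0)// subr_ge0 ltW//.
  exact: sin_lt_id.
rewrite /line_dist divr1 sqrtr1 mul1r; set p := slope beta; set h := atan p.
have -> : p ^+ 2 + 1 = Num.sqrt (1 + p ^+ 2) ^+ 2.
  by rewrite sqr_sqrtr ?(ltW (oneDsqr_gt0 _))// addrC.
by move: (Num.sqrt _) => r; field.
Qed.

Lemma dH_ge_line_dist beta w :
  ((line_dist beta 1)%:E <= dH (0%R, 1%R) (beta, w))%E.
Proof.
apply: le_ereal_inf_tmp => _ [x [v [xv [x0 [v0 [x1 [_ ->]]]]]]].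
have := lengthH_ge_line_dist (b := beta) xv; rewrite x0 v0 subr0; exact.
Qed.

Lemma Dbg_le_Lambda beta th : 0 < th < 2 * pi -> psi th <= beta ->
  (Dbg beta 0 <= (Lambda beta th)%:E)%E.
Proof.
move=> thpi /(exists_cyc_x thpi)[s s0 <-]; have /andP[th0 _] := thpi.
rewrite Lambda_cyc_x ?sin_lt_id//.
apply: (@le_trans _ _ ((2^-1)%:E *
    (dH (0%R, 1%R) (cyc_x s th + 0 * cyc_v s th, cyc_v s th)%R ^+ 2))%E).
  (* The free height on the line is taken to be that of the endpoint of the arc. *)
  by apply: ereal_inf_lbound; exists (cyc_v s th) => //=; exact: cyc_v_ge0.
rewrite mul0r addr0; have dle := dH_cycloid_le s (ltW th0).
have d0 : (0 <= dH (0%R, 1%R) (cyc_x s th, cyc_v s th))%E.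
  by apply: le_ereal_inf_tmp => _ [x [v [_ [_ [_ [_ [_ ->]]]]]]]; exact: lengthH_ge0.
have -> : (s ^+ 2 + 1) / 2 * th ^+ 2 =
    2^-1 * ((th * Num.sqrt (s ^+ 2 + 1)) * (th * Num.sqrt (s ^+ 2 + 1))).
  rewrite -{1}(@sqr_sqrtr _ (s ^+ 2 + 1)) ?addr_ge0 ?sqr_ge0//.
  by move: (Num.sqrt _) => r; field.
by rewrite expe2 !EFinM lee_wpmul2l ?lee_fin ?invr_ge0// lee_pmul.
Qed.

End FootPoint.

Unset Implicit Arguments.
Set Strict Implicit.

Theorem theorem2p5 (R : realType) (beta : R) (hbeta : 0 < beta) :
  Dbg beta 0 =
  ereal_inf [set (Lambda beta th)%:E | th in [set th : R | 0 < th <= psi_inv beta]].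
Proof.
have p0 := slope_gt0 hbeta; have /andP[a0 _] := atan_2_itv2 p0.
have [/andP[_ ipi] _] := psi_invP hbeta.
apply/eqP; rewrite eq_le; apply/andP; split.
  apply: le_ereal_inf_tmp => _ [th /= thi <-]; apply: Dbg_le_Lambda.
    by have /andP[-> /le_lt_trans->] := thi.
  exact: psi_le_of_le_psi_inv.
apply: le_ereal_inf_tmp => _ [w _ <-]; rewrite mul0r addr0.
(* The orthogonal arc links the two sides: its [Lambda] value bounds the infimum from above and is
   the calibration bound, valid for every [w]. *)
apply: (@le_trans _ _ (Lambda beta (2 * atan (slope beta)))%:E).
  apply: ereal_inf_lbound; exists (2 * atan (slope beta)) => //=.
  by rewrite a0 atan_2_le_psi_inv.
have L0 : 0 <= line_dist beta 1.
  by rewrite /line_dist divr1 !mulr_ge0 ?sqrtr_ge0// ltW// atan_gt0.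
rewrite Lambda_slope// expe2 !EFinM lee_wpmul2l ?lee_fin ?invr_ge0//.
by rewrite lee_pmul ?lee_fin// dH_ge_line_dist.
Qed.
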